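(* Let $\mathbf{X}=(X_1,\dots,X_n)\in L^1(\Omega,\mathcal{F},\mathbb{P})^n$ with $X_i\ge 0$, let $\alpha\in(0,1)$, $c\ge 0$, $0<\beta_1<\beta_2<\cdots<\beta_n$. Let $C(c)$ be the set of minimizers of $\sum_{i=1}^n\beta_i\,\mathbb{E}(R_i)$ over all random vectors $\mathbf{R}=(R_1,\dots,R_n)$ with $0\le R_i\le X_i$ for all $i$ and $\mathrm{VaR}_\alpha\big(\sum_{i=1}^nX_i-\sum_{i=1}^nR_i\big)\le c$. Define $\phi:\mathbb{R}^n\to\mathbb{R}^n$ by $$\phi_i(\mathbf{x})=\Big(\sum_{j=i}^nx_j-c\Big)_+\wedge x_i\quad(1\le i\le n-1),\qquad \phi_n(\mathbf{x})=(x_n-c)_+,$$ write $\boldsymbol\beta\,\phi(\mathbf{X}):=\sum_{i=1}^n\beta_i\phi_i(\mathbf{X})$, and let $q:=\mathrm{VaR}_\alpha(\boldsymbol\beta\,\phi(\mathbf{X}))$. (a) If $\mathbb{P}(\boldsymbol\beta\,\phi(\mathbf{X})<q)=\alpha$, then $C(c)$ is a singleton containing $$\mathbf{R}^*=\begin{cases}\mathbf{0}, & \boldsymbol\beta\,\phi(\mathbf{X})\ge q,\\ \phi(\mathbf{X}), & \boldsymbol\beta\,\phi(\mathbf{X})<q.\end{cases}$$ (b) If $\mathbb{P}(\boldsymbol\beta\,\phi(\mathbf{X})<q)<\alpha$ and the probability space is atomless, then $C(c)$ is no longer a singleton, and it contains $\mathbf{R}^*$ satisfying $$\mathbf{R}^*=\begin{cases}\mathbf{0},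 & \boldsymbol\beta\,\phi(\mathbf{X})>q,\\ \phi(\mathbf{X}), & \boldsymbol\beta\,\phi(\mathbf{X})<q,\\ B\cdot\phi(\mathbf{X}), & \boldsymbol\beta\,\phi(\mathbf{X})=q,\end{cases}$$ where $B\in\{0,1\}$ is a random variable satisfying $$\int_{\{\boldsymbol\beta\,\phi(\mathbf{X})=q\}}B\,d\mathbb{P}=\alpha-\mathbb{P}(\boldsymbol\beta\,\phi(\mathbf{X})<q);$$ the existence of such a $B$ is guaranteed by the atomlessness of the probability space.
   Context: $(\Omega,\mathcal{F},\mathbb{P})$ is a probability space; random variables are identified when $\mathbb{P}$-almost surely equal, relations between them hold $\mathbb{P}$-almost surely, and the $R_i$ are arbitrary random variables on this space (not necessarily $\sigma(\mathbf{X})$-measurable). The law of $\mathbf{X}$ is not assumed to be absolutely continuous. For a random variable $Z$ with distribution function $F_Z$, $\mathrm{VaR}_\alpha(Z):=\inf\{x:F_Z(x)\ge\alpha\}$. Notation: $x_+=\max(x,0)$, $x\wedge y=\min(x,y)$.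
   Formalization: In (b), ''C(c) is no longer a singleton'' is stated only for q > 0 and P(βφ(X) ≤ q) > α; otherwise it is false: if q = 0 (e.g. X = 0) then C(c) = {0}, and if P(βφ(X) ≤ q) = α then C(c) is a singleton. *)

(* Defs.v *)
From HB Require Import structures.
From mathcomp Require Import all_boot all_order all_algebra.
From mathcomp Require Import all_classical all_reals all_analysis measurable_realfun.
Import Order.TTheory GRing.Theory Num.Theory.
Import numFieldNormedType.Exports.

Set Implicit Arguments.
Unset Strict Implicit.
Unset Printing Implicit Defensive.

Local Open Scope classical_set_scope.
Local Open Scope ring_scope.

Section allocation_map.
Context {R : realType} {n : nat}.
Implicit Types (x beta : 'I_n -> R) (c : R).

(* Indices run over 0, ..., n-1, so i.+1 == n singles out the last one. *)
Definition phi c x (i : 'I_n) : R :=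
  if i.+1 == n then Num.max (x i - c) 0
  else Num.min (Num.max (\sum_(j < n | (i <= j)%N) x j - c) 0) (x i).

Definition beta_phi beta c x : R := \sum_(i < n) beta i * phi c x i.

End allocation_map.

Section random_vectors.
Context {d : measure_display} {T : measurableType d} {R : realType}.
Variable P : probability T R.

Definition VaR (alpha : R) (Z : {RV P >-> R}) : R :=
  inf [set x : R | (alpha%:E <= cdf Z x)%E].

Definition atomless : Prop :=
  forall A : set T, measurable A -> (0 < P A)%E ->
  exists B : set T,
    [/\ measurable B, B `<=` A, (0 < P B)%E & (P B < P A)%E].

Variable n : nat.
Implicit Types (X Y : 'I_n -> {RV P >-> R}) (beta : 'I_n -> R) (c alpha : R).

Definition feasible alpha c X Y : Prop :=
  (forall i, {ae P, forall t, 0 <= Y i t <= X i t}) /\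
  VaR alpha (\sum_(i < n) X i - \sum_(i < n) Y i) <= c.

Definition cost beta Y : \bar R := (\sum_(i < n) (beta i)%:E * 'E_P[Y i])%E.

Definition minimizers alpha c beta X : set ('I_n -> {RV P >-> R}) :=
  [set Y | feasible alpha c X Y /\
           forall Y', feasible alpha c X Y' -> (cost beta Y <= cost beta Y')%E].

(* Random vectors are identified when they are almost surely equal, so "C is
   the singleton containing Y" is understood up to almost sure equality. *)
Definition ae_singleton (C : set ('I_n -> {RV P >-> R})) Y : Prop :=
  C Y /\ forall Y', C Y' -> forall i, {ae P, forall t, Y' i t = Y i t}.

Lemma measurable_phi c X i :
  measurable_fun [set: T] (fun t => phi c (fun j => X j t) i).
Proof.
rewrite /phi; case: (i.+1 == n).
  apply: (@measurable_maxr _ _ _ _ (fun t => X i t - c) (cst 0)) => //.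
  by apply: measurable_funB.
pose s t := \sum_(j < n | (i <= j)%N) X j t - c.
apply: (@measurable_minr _ _ _ _ (fun t => Num.max (s t) 0) (X i)) => //.
apply: (@measurable_maxr _ _ _ _ s (cst 0)) => //.
apply: measurable_funB => //; under eq_fun do rewrite big_mkcond.
by apply: measurable_sum => j; case: (i <= j)%N.
Qed.

Lemma measurable_beta_phi beta c X :
  measurable_fun [set: T] (fun t => beta_phi beta c (fun j => X j t)).
Proof.
apply: measurable_sum => i.
by apply: measurable_funM => //; exact: measurable_phi.
Qed.

Definition beta_phiRV beta c X : {RV P >-> R} :=
  mfun_Sub (mem_set (measurable_beta_phi beta c X)).

Definition Rstar_fun beta c (q : R) (B : T -> R) X (i : 'I_n) (t : T) : R :=
  if beta_phiRV beta c X t < q then phi c (fun j => X j t) i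
  else if beta_phiRV beta c X t == q then B t * phi c (fun j => X j t) i
  else 0.

Lemma measurable_Rstar beta c q (B : {RV P >-> R}) X i :
  measurable_fun [set: T] (Rstar_fun beta c q B X i).
Proof.
have mphi := measurable_phi c X i.
apply: measurable_fun_ifT => //=.
  by apply: measurable_fun_ltr => //; exact: measurable_beta_phi.
apply: measurable_fun_ifT => //=.
  by apply: measurable_fun_eqr => //; exact: measurable_beta_phi.
by apply: measurable_funM.
Qed.

Definition Rstar beta c q (B : {RV P >-> R}) X (i : 'I_n) : {RV P >-> R} :=
  mfun_Sub (mem_set (measurable_Rstar beta c q B X i)).

Definition Rstar0_fun beta c (q : R) X (i : 'I_n) (t : T) : R :=
  if q <= beta_phiRV beta c X t then 0 else phi c (fun j => X j t) i.

Lemma measurable_Rstar0 beta c q X i :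
  measurable_fun [set: T] (Rstar0_fun beta c q X i).
Proof.
apply: measurable_fun_ifT => //=; last exact: measurable_phi.
by apply: measurable_fun_ler => //; exact: measurable_beta_phi.
Qed.

Definition Rstar0 beta c q X (i : 'I_n) : {RV P >-> R} :=
  mfun_Sub (mem_set (measurable_Rstar0 beta c q X i)).

(* B selects from {beta_phi(X) = q} an event of the mass missing to reach
   alpha; its values off that event are irrelevant. *)
Definition selector beta c (q alpha : R) X (B : {RV P >-> R}) : Prop :=
  {ae P, forall t, B t = 0 \/ B t = 1} /\
  (\int[P]_(t in [set t | beta_phiRV beta c X t = q]) (B t)%:E =
     alpha%:E - P [set t | (beta_phiRV beta c X t < q)%R])%E.

End random_vectors.

(* Main.v *)
(** Pointwise, summation by parts in the tail sums [\sum_(j >= i) r_j] shows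
    that [phi x] is the unique cheapest [0 <= r <= x] with
    [\sum x - \sum r <= c]: its tail sums [max(\sum_(j >= i) x_j - c, 0)] are
    the least possible ones, and the weights [beta_i - beta_(i-1)] are positive.
    For the stochastic problem, let [A] be the event where [Y] covers the risk
    and [W = beta phi(X)].  Then
    [beta Y >= 1_A W >= q 1_A + 1_(W < q) (W - q)]; as [q >= 0] and
    [P(A) >= alpha], the cost is at least [q alpha + E(1_(W < q) (W - q))].
    The vectors [Rstar] attain this bound, and equality forces
    [Y = phi(X) 1_A] with [{W < q} <= A <= {W <= q}] almost surely.
    On an atomless space an exhaustion argument produces events of any mass
    inside [{W = q}], whence the selectors. *)

Require Import Defs.
From mathcomp Require Import all_boot all_order all_algebra.
From mathcomp Require Import all_classical all_reals all_analysis measurable_realfun.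
From mathcomp Require Import lra.
Import Order.TTheory GRing.Theory Num.Theory.
Import numFieldNormedType.Exports.

Set Implicit Arguments.
Unset Strict Implicit.
Unset Printing Implicit Defensive.

Local Open Scope classical_set_scope.
Local Open Scope ring_scope.

(** * Tail sums and the pointwise optimality of [phi] *)

Section tail_sums.
Context {R : realType} {n : nat}.
Implicit Types (x y u beta : 'I_n -> R) (c : R) (k : nat).

Definition tail x k : R := \sum_(j < n | (k <= j)%N) x j.

Lemma tail_step x (i : 'I_n) : tail x i = x i + tail x i.+1.
Proof.
rewrite /tail (bigD1 i)//=; congr (_ + _); apply: eq_bigl => j.
by rewrite ltn_neqAle andbC eq_sym.
Qed.

Lemma tail_eq0 x k : (n <= k)%N -> tail x k = 0.
Proof.
move=> nk; rewrite /tail big_pred0// => j; apply/negbTE; rewrite -ltnNge.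
exact: leq_trans (ltn_ord j) nk.
Qed.

Lemma tail0 x : tail x 0 = \sum_i x i.
Proof. by []. Qed.

Lemma tailB x y k : tail (fun i => x i - y i) k = tail x k - tail y k.
Proof. by rewrite /tail sumrB. Qed.

Lemma tail_ge0 x k : (forall i, 0 <= x i) -> 0 <= tail x k.
Proof. by move=> x0; apply: sumr_ge0. Qed.

(** A common form for both branches of [phi], chosen so that tail sums of [phi] telescope. *)
Lemma phiE c x i : 0 <= c -> (forall j, 0 <= x j) ->
  phi c x i = Num.max (tail x i - c) 0 - Num.max (tail x i.+1 - c) 0.
Proof.
move=> c0 x0; have t0 := tail_ge0 i.+1 x0; have xi0 := x0 i.
rewrite /phi -/(tail x i) tail_step.
(* At the last index the tail beyond is empty, and [c >= 0] makes the subtracted term 0. *)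
case: eqP => [->|_].
  rewrite tail_eq0// addr0 sub0r.
  by rewrite [Num.max (- c) 0]max_r ?oppr_le0// subr0.
by do 2 (case: (lerP (_ - c) 0) => ?); case: lerP => ?; lra.
Qed.

Lemma tail_phi c x k : 0 <= c -> (forall j, 0 <= x j) ->
  tail (phi c x) k = Num.max (tail x k - c) 0.
Proof.
move=> c0 x0; have [nk|] := leqP n k.
  by rewrite !tail_eq0// sub0r max_r// oppr_le0.
(* Downward induction on [k], written as [n - m]. *)
move=> kn; rewrite -(subKn (ltnW kn)); move: (n - k)%N => m.
elim: m => [|m IH]; first by rewrite subn0 !tail_eq0// sub0r max_r// oppr_le0.
(* For [n <= m] both truncated subtractions are 0, so the claim is [IH] itself. *)
have [nm|mn] := leqP n m.
  by move: IH; rewrite (eqP (nm : n - m == 0)%N) (eqP (leqW nm : n - m.+1 == 0)%N).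
have ltm : (n - m.+1 < n)%N by rewrite ltn_subrL/= (leq_trans _ mn).
have e : (n - m)%N = (Ordinal ltm).+1 by rewrite /= subnSK.
rewrite -[(n - m.+1)%N]/(nat_of_ord (Ordinal ltm)) tail_step -e IH e phiE//.
by rewrite subrK.
Qed.

Lemma phi_bounds c x i : 0 <= c -> (forall j, 0 <= x j) ->
  0 <= phi c x i <= x i.
Proof.
move=> c0 x0; have xi0 := x0 i; have t0 := tail_ge0 i.+1 x0.
rewrite phiE// tail_step.
by do 2 (case: (lerP (_ - c) 0) => ?); apply/andP; lra.
Qed.

Lemma sum_phi c x : 0 <= c -> (forall j, 0 <= x j) ->
  \sum_i phi c x i = Num.max (\sum_i x i - c) 0.
Proof. by move=> c0 x0; rewrite -!tail0 tail_phi. Qed.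

Section abel.
Variables (beta : 'I_n -> R).
Hypothesis beta_gt0 : forall i, 0 < beta i.
Hypothesis beta_incr : forall i j : 'I_n, (i < j)%N -> beta i < beta j.

(** Extending [beta] by 0 to all naturals lets its increments [w], with [w 0 = b 0], be summed by
    plain induction. *)
Let b k := if insub k is Some i then beta i else 0.
Let w k := b k - (if k is k'.+1 then b k' else 0).

Let bE (i : 'I_n) : b i = beta i.
Proof. by rewrite /b valK. Qed.

Let w_gt0 (i : 'I_n) : 0 < w i.
Proof.
rewrite /w bE; case: i => -[|k] kn /=; first by rewrite subr0.
have kn' : (k < n)%N by exact: ltnW.
by rewrite -[k]/(val (Ordinal kn')) bE subr_gt0 beta_incr.
Qed.

Let sum_w k : \sum_(i < k.+1) w i = b k.
Proof.
elim: k => [|k IH]; first by rewrite big_ord1 /w subr0.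
by rewrite big_ord_recr/= IH /w addrC subrK.
Qed.

(** Summation by parts: [beta j] is the sum of the [w i] with [i <= j], and the two sums are
    exchanged. *)
Let abel u : \sum_i beta i * u i = \sum_(i < n) w i * tail u i.
Proof.
under [RHS]eq_bigr do rewrite /tail mulr_sumr.
rewrite (exchange_big_dep xpredT)//=; apply: eq_bigr => j _.
rewrite -mulr_suml -bE -sum_w; congr (_ * _).
by rewrite (big_ord_widen n w (ltn_ord j)).
Qed.

Lemma weighted_sum_ge0 u : (forall i : 'I_n, 0 <= tail u i) ->
  0 <= \sum_i beta i * u i.
Proof.
by move=> u0; rewrite abel sumr_ge0// => i _; rewrite mulr_ge0// ltW.
Qed.

(** Positive weights force every tail sum to vanish, and each [u i] is a difference of consecutive
    tail sums. *)
Lemma weighted_sum_eq0 u : (forall i : 'I_n, 0 <= tail u i) ->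
  \sum_i beta i * u i = 0 -> forall i, u i = 0.
Proof.
move=> u0; rewrite abel => /eqP; rewrite psumr_eq0; last first.
  by move=> i _; rewrite mulr_ge0// ltW.
move=> /allP w0; have t0 (i : 'I_n) : tail u i = 0.
  have := w0 i (mem_index_enum i); rewrite /= mulf_eq0 gt_eqF//=.
  by move/eqP.
move=> i; have := tail_step u i; rewrite t0.
have [ni|ni] := leqP n i.+1; first by rewrite tail_eq0// addr0.
by rewrite -[i.+1]/(nat_of_ord (Ordinal ni)) t0 addr0.
Qed.

(** Since [x - y >= 0], any tail of [x - y] is at most its total, hence at most [c]; tails of [y]
    are also nonnegative. *)
Lemma tail_ge_phi c x y : 0 <= c -> (forall i, 0 <= y i <= x i) ->
  \sum_i x i - \sum_i y i <= c -> forall k, tail (phi c x) k <= tail y k.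
Proof.
move=> c0 yx xyc k.
have y0 i : 0 <= y i by case/andP: (yx i).
have yx' i : y i <= x i by case/andP: (yx i).
have x0 i : 0 <= x i by rewrite (le_trans (y0 i)).
rewrite tail_phi// ge_max tail_ge0// andbT lerBlDr -lerBlDl -tailB.
apply: le_trans xyc; rewrite -sumrB -tail0 /tail big_mkcond ler_sum//= => i _.
by case: ifP => // _; rewrite subr_ge0.
Qed.

Lemma beta_phi_le c x y : 0 <= c -> (forall i, 0 <= y i <= x i) ->
  \sum_i x i - \sum_i y i <= c ->
  beta_phi beta c x <= \sum_i beta i * y i.
Proof.
move=> c0 yx xyc; rewrite -subr_ge0 /beta_phi -sumrB.
under eq_bigr do rewrite -mulrBr.
by apply: weighted_sum_ge0 => i; rewrite tailB subr_ge0; exact: tail_ge_phi.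
Qed.

Lemma beta_phi_unique c x y : 0 <= c -> (forall i, 0 <= y i <= x i) ->
  \sum_i x i - \sum_i y i <= c ->
  \sum_i beta i * y i = beta_phi beta c x -> forall i, y i = phi c x i.
Proof.
move=> c0 yx xyc e i; apply/eqP; rewrite -subr_eq0; apply/eqP; move: i.
apply: weighted_sum_eq0 => [i|]; first by rewrite tailB subr_ge0; exact: tail_ge_phi.
by under eq_bigr do rewrite mulrBr; rewrite sumrB e subrr.
Qed.

End abel.

End tail_sums.

(** * Measurability of level sets *)

Section level_sets.
Context {d : measure_display} {T : measurableType d} {R : realType}.
Variable Z : {mfun T >-> R}.

Lemma measurable_sublevel x : measurable [set t | Z t <= x].
Proof.
rewrite (_ : [set t | _] = Z @^-1` `]-oo, x]); first exact: measurable_funPTI.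
by apply/seteqP; split => t /=; rewrite in_itv.
Qed.

Lemma measurable_strict_sublevel x : measurable [set t | Z t < x].
Proof.
rewrite (_ : [set t | _] = Z @^-1` `]-oo, x[); first exact: measurable_funPTI.
by apply/seteqP; split => t /=; rewrite in_itv.
Qed.

Lemma measurable_level x : measurable [set t | Z t = x].
Proof.
rewrite (_ : [set t | _] = Z @^-1` [set x])//; exact: measurable_funPTI.
Qed.

End level_sets.

(** * Value at risk as an attained quantile *)

Section value_at_risk.
Context {d : measure_display} {T : measurableType d} {R : realType}.
Variable P : probability T R.
Variables (alpha : R) (Z : {RV P >-> R}).
Hypothesis alpha01 : 0 < alpha < 1.

Let S := [set x : R | (alpha%:E <= cdf Z x)%E].

Let cdfE x : cdf Z x = P [set t | Z t <= x].
Proof. by congr (P _); apply/seteqP; split => t /=; rewrite in_itv. Qed.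

Let S_up x y : x <= y -> S x -> S y.
Proof. by move=> xy /le_trans; apply; exact: cdf_nondecreasing. Qed.

Let S_nonempty : S !=set0.
Proof.
apply: contrapT => nS.
have : (1 <= alpha%:E)%E.
  apply: (cvge_le _ (cvg_cdfy1 Z)); near=> x; apply: ltW; rewrite ltNge.
  by apply/negP => Sx; apply: nS; exists x.
by rewrite lee_fin leNgt; case/andP: alpha01 => _ ->.
Unshelve. all: by end_near. Qed.

Let S_lbound : has_lbound S.
Proof.
apply: contrapT => nS.
have : (alpha%:E <= 0)%E.
  apply: (cvge_ge _ (cvg_cdfNy0 Z)); near=> x; apply: contrapT => nSx.
  apply: nS; exists x => y Sy; rewrite leNgt; apply/negP => /ltW yx.
  exact/nSx/(S_up yx).
by rewrite lee_fin leNgt; case/andP: alpha01 => ->.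
Unshelve. all: by end_near. Qed.

(** The infimum is attained because distribution functions are right continuous. *)
Let S_inf : S (inf S).
Proof.
apply: (cvge_ge _ (@cdf_right_continuous _ _ _ _ Z (inf S))).
near=> x; have : inf S < x by near: x; exact: nbhs_right_gt.
by move=> /(inf_lt S_nonempty)[y Sy /ltW yx]; exact: S_up Sy.
Unshelve. all: by end_near. Qed.

(** Turns the risk constraint into a lower bound on the probability of an event. *)
Lemma VaR_le x : VaR alpha Z <= x <-> (alpha%:E <= P [set t | (Z t <= x)%R])%E.
Proof.
rewrite -cdfE; split=> [Sx|Sx]; first exact: S_up Sx S_inf.
exact: ge_inf.
Qed.

(** Otherwise the event that [Z] is at most its quantile, of mass at least [alpha > 0], would lie in
    a null event. *)
Lemma VaR_ge x : P [set t | Z t < x] = 0%E -> x <= VaR alpha Z.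
Proof.
case/andP: alpha01 => a0 _ Z0; rewrite leNgt; apply/negP => qx.
have /VaR_le : VaR alpha Z <= VaR alpha Z by [].
rewrite leNgt => /negP; apply.
rewrite (_ : P _ = 0%E) ?lte_fin//; apply: (subset_measure0 _ _ _ Z0) => //.
- exact: measurable_sublevel.
- exact: measurable_strict_sublevel.
- by move=> t /= h; exact: le_lt_trans h qx.
Qed.

End value_at_risk.

(** * Intermediate values of an atomless probability (Sierpinski) *)

Section atomless_intermediate_values.
Context {d : measure_display} {T : measurableType d} {R : realType}.
Variable P : probability T R.
Implicit Types A B E F : set T.

Let p A : R := fine (P A).

Let pE A : measurable A -> P A = (p A)%:E.
Proof. by move=> mA; rewrite fineK// fin_num_measure. Qed.

Let p_ge0 A : 0 <= p A.
Proof. exact: fine_ge0. Qed.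

Let p_le1 A : measurable A -> p A <= 1.
Proof. by move=> mA; rewrite -lee_fin -pE// probability_le1. Qed.

Let p_mono A B : measurable A -> measurable B -> A `<=` B -> p A <= p B.
Proof. by move=> mA mB AB; rewrite -lee_fin -!pE// le_measure// inE. Qed.

Let pD A B : measurable A -> measurable B -> B `<=` A ->
  p (A `\` B) = p A - p B.
Proof.
move=> mA mB BA; apply: EFin_inj; rewrite EFinB -!pE//; last exact: measurableD.
rewrite measureD//; last by rewrite ltey_eq fin_num_measure.
by rewrite setIC setIidl.
Qed.

Let pU A B : measurable A -> measurable B -> [disjoint A & B] ->
  p (A `|` B) = p A + p B.
Proof.
move=> mA mB AB; apply: EFin_inj; rewrite EFinD -!pE//; last exact: measurableU.
by rewrite measureU//; apply/eqP; rewrite -disj_set2E.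
Qed.

Hypothesis P_atomless : atomless P.

(** Atomlessness splits [E] into two pieces of positive mass; the lighter one has at most half. *)
Let halving E : measurable E -> 0 < p E ->
  exists F, [/\ measurable F, F `<=` E, 0 < p F & 2 * p F <= p E].
Proof.
move=> mE E0; have [|B [mB BE]] := P_atomless mE; first by rewrite pE// lte_fin.
rewrite !pE// !lte_fin => B0 BltE; have := pD mE mB BE => pEB.
have [h|h] := leP (2 * p B) (p E); first by exists B.
exists (E `\` B); split; [exact: measurableD|exact: subDsetl|lra|lra].
Qed.

Lemma atomless_small_subset E (eps : R) : measurable E -> 0 < p E -> 0 < eps ->
  exists F, [/\ measurable F, F `<=` E, 0 < p F & p F <= eps].
Proof.
move=> mE E0 eps0.
(* Repeated halving gives a factor [2 ^ k]; the weaker factor [k + 1] suffices for the Archimedean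
   argument. *)
have iterated k : exists F,
    [/\ measurable F, F `<=` E, 0 < p F & k.+1%:R * p F <= p E].
  elim: k => [|k [F [mF FE F0 kF]]]; first by exists E; split => //; rewrite mul1r.
  have [G [mG GF G0 FG]] := halving mF F0.
  exists G; split => //; first exact: subset_trans FE.
  have kG : 0 <= k%:R * p G by rewrite mulr_ge0.
  have kFG : 0 <= k.+1%:R * (p F - 2 * p G) by rewrite mulr_ge0// subr_ge0.
  by move: kF kFG; rewrite -[k.+2%:R]natr1 -natr1; lra.
have [F [mF FE F0 kF]] := iterated (Num.bound eps^-1).
exists F; split => //; have pE1 := p_le1 mE.
have epsV : 0 <= eps^-1 by rewrite invr_ge0 ltW.
have := archi_boundP epsV; set m := Num.bound _ in kF *.
rewrite -[_^-1]mul1r ltr_pdivrMr// => m1.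
rewrite -(ler_pM2l (ltr0Sn R m)) -natr1 mulrDl mul1r; move: kF; rewrite -natr1; lra.
Qed.

Section exhaustion.
Variables (E : set T) (a : R).
Hypotheses (mE : measurable E) (a_ge0 : 0 <= a) (aE : a <= p E).

Let admissible B := [/\ measurable B, B `<=` E & p B <= a].

Let candidate B F := [/\ measurable F, F `<=` E `\` B & p F <= a - p B].

(** Some candidate has at least half the supremal mass of all sets that can still be added to
    [B]. *)
Let greedy B : admissible B ->
  exists F, candidate B F /\ forall G, candidate B G -> p G <= 2 * p F.
Proof.
move=> [mB BE Ba]; pose S := [set p F | F in candidate B].
have S0 : S 0.
  by exists set0; [split => //; rewrite /p measure0/= subr_ge0|rewrite /p measure0].
have supS : has_sup S.
  by split; [exists 0|exists 1 => _ [F [mF _ _] <-]; exact: p_le1].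
have ubS G : candidate B G -> p G <= sup S.
  by move=> cG; apply: ub_le_sup; [case: supS|exists G].
(* If the supremum is 0, the empty set already works. *)
have [s0|s0] := ltP 0 (sup S); last first.
  exists set0; split; first by split => //; rewrite /p measure0/= subr_ge0.
  move=> G /ubS /le_trans; apply; rewrite (le_trans s0)//.
  by rewrite mulr_ge0// p_ge0.
have [_ [F cF <-] sF] := sup_adherent (divr_gt0 s0 (ltr0Sn _ 1)) supS.
by exists F; split => // G /ubS; lra.
Qed.

Let next (B : {B | admissible B}) : exists B' : {B | admissible B},
  sval B `<=` sval B' /\
  forall G, candidate (sval B) G -> p G <= 2 * (p (sval B') - p (sval B)).
Proof.
case: B => B aB; have [F [[mF FEB Fa] Fmax]] := greedy aB.
have [mB BE Ba] := aB.
have pBF : p (B `|` F) = p B + p F.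
  rewrite pU//; apply/disj_setPLR.
  by move=> t Bt /FEB[].
have aBF : admissible (B `|` F).
  split; [exact: measurableU|by rewrite subUset; split => // t /FEB[]|].
  by rewrite pBF; lra.
exists (exist _ _ aBF); split => [|G /Fmax] /=; first exact: subsetUl.
by rewrite pBF; lra.
Qed.

(** The union of the greedy sequence has mass [a]: otherwise a small set left in [E] would stay a
    candidate at every stage, and each stage would gain at least half its mass. *)
Lemma atomless_subset_of_measure : exists B, [/\ measurable B, B `<=` E & P B = a%:E].
Proof.
have [f fP] := choice next.
have a0 : admissible set0 by split => //; rewrite /p measure0.
pose B k := sval (iter k f (exist _ _ a0)).
have aB k : admissible (B k) by rewrite /B; case: (iter k f _).
have mB k : measurable (B k) by case: (aB k).
have BS k : B k `<=` B k.+1 by have [] := fP (iter k f (exist _ _ a0)).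
have Bmax k G : candidate (B k) G -> p G <= 2 * (p (B k.+1) - p (B k)).
  by have [_] := fP (iter k f (exist _ _ a0)); exact.
have Bnd : nondecreasing_seq B.
  by apply/nondecreasing_seqP => k; apply/subsetPset.
pose U := \bigcup_k B k.
have mU : measurable U by exact: bigcup_measurable.
have UE : U `<=` E by move=> t [k _ Bkt]; have [_ BE _] := aB k; exact: BE.
have Ua : p U <= a.
  rewrite -lee_fin -pE//.
  apply: (cvge_le _ (nondecreasing_cvg_mu (mu := P) mB mU Bnd)).
  by apply: nearW => k /=; rewrite pE// lee_fin; case: (aB k).
exists U; split => //; rewrite pE//; congr EFin; apply/eqP; rewrite eq_le Ua/=.
rewrite leNgt; apply/negP => Ult.
have mEU : measurable (E `\` U) by exact: measurableD.
have EU0 : 0 < p (E `\` U) by rewrite pD// subr_gt0 (lt_le_trans Ult).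
have aU0 : 0 < a - p U by rewrite subr_gt0.
have [F [mF FEU F0 Fa]] := atomless_small_subset mEU EU0 aU0.
have gain k : k%:R * p F <= 2 * p (B k).
  elim: k => [|k IH]; first by rewrite mul0r mulr_ge0.
  have cF : candidate (B k) F.
    split => //; first by move=> t /FEU[Et Ut]; split => // Bt; apply: Ut; exists k.
    by have : p (B k) <= p U by [apply: p_mono => //; exact: bigcup_sup]; lra.
  by rewrite -natr1; have := Bmax k F cF; lra.
(* At an index beyond [2 / p F] the gain exceeds what [p <= 1] permits. *)
have := gain (Num.bound (2 / p F)).
have := archi_boundP (divr_ge0 (ler0n R 2) (ltW F0)).
rewrite ltr_pdivrMr// => h1 h2.
by have := p_le1 (mB (Num.bound (2 / p F))); lra.
Qed.

End exhaustion.

End atomless_intermediate_values.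

(** * Pointwise duality gap *)

Section pointwise_gap.
Context {R : realType} {n : nat}.
Variables (beta : 'I_n -> R) (c q : R).
Hypothesis beta_gt0 : forall i, 0 < beta i.
Hypothesis beta_incr : forall i j : 'I_n, (i < j)%N -> beta i < beta j.
Hypotheses (c_ge0 : 0 <= c) (q_ge0 : 0 <= q).
Implicit Types x y : 'I_n -> R.

Definition covered x y : bool := \sum_i x i - \sum_i y i <= c.

(* Lagrangian gap: the multiplier of the probability constraint is [q]. *)
Definition gap x y : R :=
  \sum_i beta i * y i - (beta_phi beta c x < q)%R%:R * (beta_phi beta c x - q)
  - q * (covered x y)%:R.

Lemma beta_phi_ge0 x : (forall i, 0 <= x i) -> 0 <= beta_phi beta c x.
Proof.
move=> x0; apply: sumr_ge0 => i _; rewrite mulr_ge0 ?(ltW (beta_gt0 _))//.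
by have /andP[] := phi_bounds i c_ge0 x0.
Qed.

Lemma beta_phi_bound x : (forall i, 0 <= x i) ->
  beta_phi beta c x <= \sum_i beta i * x i.
Proof.
move=> x0; apply: ler_sum => i _; rewrite ler_wpM2l ?(ltW (beta_gt0 _))//.
by have /andP[] := phi_bounds i c_ge0 x0.
Qed.

Lemma covered_phi x : (forall i, 0 <= x i) -> covered x (phi c x).
Proof.
by move=> x0; rewrite /covered sum_phi//; case: (lerP (_ - c) 0) => ?; lra.
Qed.

(** Let [V] be the cost of [y] and [W = beta_phi beta c x]. The gap is [(V - W) + max(W - q, 0)] if
    [y] covers, and [V + max(q - W, 0)] otherwise. *)
Lemma gap_ge0 x y : (forall i, 0 <= y i <= x i) -> 0 <= gap x y.
Proof.
move=> yx; have y0 i : 0 <= y i by case/andP: (yx i).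
have V0 : 0 <= \sum_i beta i * y i by rewrite sumr_ge0// => i _; rewrite mulr_ge0 ?(ltW (beta_gt0 _)).
have := beta_phi_le beta_gt0 beta_incr c_ge0 yx.
rewrite /gap -/(covered x y); case: (covered x y) => [/(_ isT)|_];
  case: ltP => /= ?; lra.
Qed.

(** Both nonnegative terms of the gap vanish; uniqueness of the cheapest cover then identifies
    [y]. *)
Lemma gap_eq0 x y : (forall i, 0 <= y i <= x i) -> gap x y = 0 ->
  if covered x y then (forall i, y i = phi c x i) /\ beta_phi beta c x <= q
  else (forall i, y i = 0) /\ q <= beta_phi beta c x.
Proof.
move=> yx; have y0 i : 0 <= y i by case/andP: (yx i).
have V0 i : true -> 0 <= beta i * y i by move=> _; rewrite mulr_ge0 ?(ltW (beta_gt0 _)).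
have sV0 : 0 <= \sum_i beta i * y i by rewrite sumr_ge0.
have := beta_phi_le beta_gt0 beta_incr c_ge0 yx.
have := beta_phi_unique beta_gt0 beta_incr c_ge0 yx.
rewrite /gap -/(covered x y); case: (covered x y) => [/(_ isT) u /(_ isT) l|_ _].
  by case: ltP => /= ? g0; split; try (apply: u; lra); lra.
case: ltP => /= ? g0; first by lra.
split => // i; have /eqP : \sum_i beta i * y i = 0 by lra.
rewrite psumr_eq0// => /allP/(_ i (mem_index_enum _)).
by rewrite /= mulf_eq0 gt_eqF//= => /eqP.
Qed.

End pointwise_gap.

(** * Real-valued integrals under almost sure hypotheses *)

Section real_valued_integrals.
Context {d : measure_display} {T : measurableType d} {R : realType}.
Variable P : probability T R.
Implicit Types f g : T -> R.

Local Notation integrableR f := (P.-integrable [set: T] (EFin \o f)).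

Lemma integrable_realD f g : integrableR f -> integrableR g ->
  integrableR (fun t => f t + g t).
Proof. exact: integrableD. Qed.

Lemma integrable_realB f g : integrableR f -> integrableR g ->
  integrableR (fun t => f t - g t).
Proof. exact: integrableB. Qed.

Lemma integrable_realZ k f : integrableR f -> integrableR (fun t => k * f t).
Proof. exact: integrableZl. Qed.

Lemma integrable_ae_le f g : measurable_fun [set: T] f -> integrableR g ->
  {ae P, forall t, `|f t| <= `|g t|} -> integrableR f.
Proof.
move=> mf /integrableP[mg goo] fg; apply/integrableP; split.
  exact/measurable_EFinP.
apply: le_lt_trans goo; apply: ae_ge0_le_integral => //.
- exact/measurableT_comp/measurable_EFinP.
- exact: measurableT_comp.
- by apply: filterS fg => t /= fg _; rewrite lee_fin.
Qed.

(** Transfers to [f] the positivity and vanishing criteria known for integrals of absolute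
    values. *)
Lemma Rintegral_ae_ge0E f : integrableR f -> {ae P, forall t, 0 <= f t} ->
  (\int[P]_t `|(f t)%:E| = (\int[P]_t f t)%:E)%E.
Proof.
move=> fi f0; rewrite /Rintegral fineK ?integrable_fin_num//.
have mf : measurable_fun [set: T] (EFin \o f) by case/integrableP: fi.
apply: ae_eq_integral => //; first exact: measurableT_comp.
by apply: filterS f0 => t /= f0 _; rewrite ger0_norm.
Qed.

Lemma Rintegral_ae_ge0 f : integrableR f -> {ae P, forall t, 0 <= f t} ->
  0 <= \int[P]_t f t.
Proof. by move=> fi f0; rewrite -lee_fin -Rintegral_ae_ge0E// integral_ge0. Qed.

Lemma Rintegral_ae_eq0 f : integrableR f -> {ae P, forall t, 0 <= f t} ->
  \int[P]_t f t = 0 -> {ae P, forall t, f t = 0}.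
Proof.
move=> fi f0 If0; have mf : measurable_fun [set: T] (EFin \o f).
  by case/integrableP: fi.
have /(ae_eq_integral_abs P measurableT mf) : (\int[P]_t `|(f t)%:E| = 0)%E.
  by rewrite Rintegral_ae_ge0E// If0.
by apply: filterS => t /= /(_ I) [].
Qed.

Lemma integrable_indicator (A : set T) (b : T -> bool) : measurable A ->
  A = [set t | b t] -> integrableR (fun t => (b t)%:R).
Proof.
move=> mA e; rewrite (_ : (fun t => _) = \1_A).
  exact: integrable_indic.
by apply/funext => t; rewrite indicE e mem_setE.
Qed.

Lemma Rintegral_indicator (A : set T) (b : T -> bool) : measurable A ->
  A = [set t | b t] -> \int[P]_t (b t)%:R = fine (P A).
Proof.
move=> mA e; rewrite (_ : (fun t => _) = \1_A).
  by rewrite /Rintegral integral_indic// setIT.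
by apply/funext => t; rewrite indicE e mem_setE.
Qed.

End real_valued_integrals.

Lemma residual_riskE d (T : measurableType d) (R : realType) (P : probability T R)
    n (X Y : 'I_n -> {RV P >-> R}) t :
  (\sum_(i < n) X i - \sum_(i < n) Y i : {RV P >-> R}) t =
  \sum_i X i t - \sum_i Y i t.
Proof.
by rewrite -[LHS]/((\sum_(i < n) X i : {mfun T >-> R}) t
  - (\sum_(i < n) Y i : {mfun T >-> R}) t) !mfun_sum.
Qed.

(** * The optimal cost *)

Section optimal_cost.
Context {d : measure_display} {T : measurableType d} {R : realType}.
Variables (P : probability T R) (n : nat) (X : 'I_n -> {RV P >-> R}).
Variables (alpha c : R) (beta : 'I_n -> R).
Hypothesis X_L1 : forall i, (X i : T -> R) \in Lfun P 1.
Hypothesis X_ge0 : forall i, {ae P, forall t, 0 <= X i t}.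
Hypothesis alpha01 : 0 < alpha < 1.
Hypothesis c_ge0 : 0 <= c.
Hypothesis beta_gt0 : forall i, 0 < beta i.
Hypothesis beta_incr : forall i j : 'I_n, (i < j)%N -> beta i < beta j.

Local Notation integrableR f := (P.-integrable [set: T] (EFin \o f)).

Let W := beta_phiRV beta c X.
Let q := VaR alpha W.

Let aeX : {ae P, forall t, forall i, 0 <= X i t}.
Proof. exact: filter_forall. Qed.

Let X_int i : integrableR (X i).
Proof. exact/Lfun1_integrable. Qed.

Let WE t : W t = beta_phi beta c (fun i => X i t).
Proof. by []. Qed.

Let W_ge0 : {ae P, forall t, 0 <= W t}.
Proof. by apply: filterS aeX => t; exact: beta_phi_ge0. Qed.

Lemma integrable_weighted_sum (Y : 'I_n -> {RV P >-> R}) :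
  (forall i, integrableR (Y i)) -> integrableR (fun t => \sum_i beta i * Y i t).
Proof.
move=> Yi; rewrite (_ : _ \o _ = fun t => \sum_i (beta i)%:E * (Y i t)%:E)%E.
  by apply: integrable_sum => // i _; exact: integrableZl (Yi i).
by apply/funext => t /=; rewrite -sumEFin.
Qed.

Lemma cost_Rintegral (Y : 'I_n -> {RV P >-> R}) :
  (forall i, integrableR (Y i)) ->
  cost beta Y = (\int[P]_t \sum_i beta i * Y i t)%:E.
Proof.
move=> Yi; rewrite /Rintegral fineK; last first.
  by apply: integrable_fin_num => //; exact: integrable_weighted_sum.
under eq_integral do rewrite -sumEFin.
rewrite integral_sum//; last first.
  move=> i; rewrite (_ : (fun t => _) = fun t => (beta i)%:E * (Y i t)%:E)%E//.
  exact: integrableZl (Yi i).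
by apply: eq_bigr => i _; rewrite unlock -(integralZl measurableT (Yi i)).
Qed.

Lemma W_integrable : integrableR W.
Proof.
apply: (integrable_ae_le _ (integrable_weighted_sum X_int)) => //.
apply: filterS aeX => t x0; rewrite ger0_norm ?WE ?beta_phi_ge0//.
by rewrite (le_trans (beta_phi_bound _ _ _))// ler_norm.
Qed.

Lemma W_lt0_null : P [set t | W t < 0] = 0%E.
Proof.
case: W_ge0 => N [mN N0 WN].
apply: (subset_measure0 _ mN _ N0); first exact: measurable_strict_sublevel.
by move=> t /= Wt; apply: WN => /=; apply/negP; rewrite -ltNge.
Qed.

Lemma VaR_W_ge0 : 0 <= q.
Proof. exact: VaR_ge W_lt0_null. Qed.

Lemma VaR_W_mass : (alpha%:E <= P [set t | (W t <= q)%R])%E.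
Proof. exact/VaR_le. Qed.

Let D := [set t | W t < q].
Let mD : measurable D.
Proof. exact: measurable_strict_sublevel. Qed.

Let E := [set t | W t = q].
Let mE : measurable E.
Proof. exact: measurable_level. Qed.

Let EE : E = [set t | W t == q].
Proof. by apply/seteqP; split => t /eqP. Qed.

(** The part of the dual bound [K + q * alpha] that does not depend on the competing vector. *)
Let K := \int[P]_t ((W t < q)%R%:R * (W t - q)).

Let K_int : integrableR (fun t => (W t < q)%R%:R * (W t - q)).
Proof.
have Wq : integrableR (fun t => W t - q).
  apply: integrable_realB W_integrable _.
  exact: finite_measure_integrable_cst.
apply: (integrable_ae_le _ Wq).
  apply: measurable_funM; last exact/measurable_EFinP/(measurable_int P).
  exact/measurable_EFinP/(measurable_int P)/(integrable_indicator P mD).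
by apply: nearW => t; case: ltP => _; rewrite ?mul1r ?mul0r ?normr0.
Qed.

(** * Lower bound for feasible vectors and its equality case *)

Section feasible_vector.
Variable Y : 'I_n -> {RV P >-> R}.
Hypothesis feasY : feasible alpha c X Y.

Let aeY : {ae P, forall t, forall i, 0 <= Y i t <= X i t}.
Proof. by apply: filter_forall; case: feasY. Qed.

Let Y_int i : integrableR (Y i).
Proof.
apply: (integrable_ae_le _ (X_int i)); first exact: measurable_funPT.
by apply: filterS aeY => t /(_ i) /andP[y0 yx]; rewrite !ger0_norm// (le_trans y0).
Qed.

Let A := [set t | covered c (fun i => X i t) (fun i => Y i t)].

Let AE : A = [set t | (\sum_i X i - \sum_i Y i : {RV P >-> R}) t <= c].
Proof. by apply/funext => t; rewrite /A /mkset residual_riskE. Qed.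

Lemma measurable_covered : measurable A.
Proof. by rewrite AE; exact: measurable_sublevel. Qed.

Lemma covered_mass : (alpha%:E <= P A)%E.
Proof. by rewrite AE; apply/VaR_le => //; case: feasY. Qed.

Let mA := measurable_covered.
Let gapXY t := gap beta c q (fun i => X i t) (fun i => Y i t).

Let gap_integrals : integrableR gapXY /\
  cost beta Y = (\int[P]_t gapXY t + K + q * fine (P A))%:E.
Proof.
have i1 := integrable_weighted_sum Y_int.
have i2 := K_int.
have i3 : integrableR (fun t => q * (covered c (fun i => X i t) (fun i => Y i t))%:R).
  exact: integrable_realZ (integrable_indicator P mA _).
have i12 : integrableR (fun t => \sum_i beta i * Y i t - (W t < q)%R%:R * (W t - q)).
  exact: integrable_realB i1 i2.
split; first exact: integrable_realB i12 i3.
rewrite cost_Rintegral// /gapXY RintegralB// RintegralB// RintegralZl//; last first.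
  exact: integrable_indicator mA _.
rewrite (Rintegral_indicator P mA)// /K.
by congr EFin; lra.
Qed.

Let gapXY_ge0 : {ae P, forall t, 0 <= gapXY t}.
Proof. by apply: filterS aeY => t; apply: gap_ge0 => //; exact: VaR_W_ge0. Qed.

Let alpha_le_A : alpha <= fine (P A).
Proof. by rewrite -lee_fin fineK ?fin_num_measure// covered_mass. Qed.

Lemma cost_ge : ((K + q * alpha)%:E <= cost beta Y)%E.
Proof.
have [gi ->] := gap_integrals; rewrite lee_fin.
have := Rintegral_ae_ge0 gi gapXY_ge0.
have : q * alpha <= q * fine (P A) by rewrite ler_wpM2l ?VaR_W_ge0.
lra.
Qed.

(** Complementary slackness: the excess cost is the integral of the gap plus [q * (P(A) - alpha)],
    both nonnegative. *)
Lemma cost_eq : cost beta Y = (K + q * alpha)%:E ->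
  q * fine (P A) = q * alpha /\
  {ae P, forall t, if covered c (fun i => X i t) (fun i => Y i t)
    then (forall i, Y i t = phi c (fun i => X i t) i) /\ W t <= q
    else (forall i, Y i t = 0) /\ q <= W t}.
Proof.
have [gi ->] := gap_integrals => -[].
have := Rintegral_ae_ge0 gi gapXY_ge0.
have : q * alpha <= q * fine (P A) by rewrite ler_wpM2l ?VaR_W_ge0.
move=> h1 h2 h3; split; first by lra.
have gap0 : \int[P]_t gapXY t = 0 by lra.
apply: filterS2 aeY (Rintegral_ae_eq0 gi gapXY_ge0 gap0) => t yx g0.
by apply: (gap_eq0 beta_gt0) g0 => //; exact: VaR_W_ge0.
Qed.

End feasible_vector.

(** * Vectors built from selectors attain the bound *)

Section selection.
Variable B : {RV P >-> R}.
Hypothesis selB : selector beta c q alpha X B.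

Let B01 : {ae P, forall t, B t = 0 \/ B t = 1}.
Proof. by case: selB. Qed.

(** Almost surely the indicator of the event on which [Rstar] equals [phi(X)] by selection; the
    factor [W t == q] discards [B] elsewhere. *)
Let mass t := (W t < q)%R%:R + (W t == q)%:R * B t.

Let B_int : integrableR (fun t => (W t == q)%:R * B t).
Proof.
apply: (@integrable_ae_le _ _ _ _ _ (cst 1)).
- apply: measurable_funM => //.
  exact/measurable_EFinP/(measurable_int P)/(integrable_indicator P mE).
- exact: finite_measure_integrable_cst.
- by apply: filterS B01 => t [] ->; rewrite ?mulr0 ?mulr1 ?normr0 ?normr1// normr_nat lern1 leq_b1.
Qed.

Let D_int : integrableR (fun t => (W t < q)%R%:R).
Proof. exact: integrable_indicator mD _. Qed.

Let mass_int : integrableR mass.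
Proof. exact: integrable_realD D_int B_int. Qed.

Let mass_integral : \int[P]_t mass t = alpha.
Proof.
rewrite /mass RintegralD// (Rintegral_indicator P mD)//.
have := proj2 selB; rewrite integral_mkcond.
rewrite (_ : _ \_ _ = fun t => ((W t == q)%:R * B t)%:E); last first.
  apply/funext => t; rewrite patchE; case: ifPn; rewrite ?inE ?notin_setE => Wq.
    by rewrite (_ : W t == q) ?mul1r//; exact/eqP.
  by rewrite (_ : (W t == q) = false) ?mul0r//; exact/eqP.
move=> e; rewrite /Rintegral e fineB ?fin_num_measure//=.
by lra.
Qed.

Let RstarE t i : Rstar beta c q B X i t = mass t * phi c (fun j => X j t) i.
Proof.
rewrite /Rstar/= /Rstar_fun /mass -/W.
by case: ltgtP; rewrite /= ?mul1r ?mul0r ?addr0 ?add0r ?mul1r ?mul0r.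
Qed.

Let mass01 : {ae P, forall t, mass t = 0 \/ mass t = 1}.
Proof.
apply: filterS B01 => t Bt; rewrite /mass.
by case: ltgtP; rewrite /= ?mul1r ?mul0r ?addr0 ?add0r ?mul1r ?mul0r; auto.
Qed.

Lemma Rstar_feasible : feasible alpha c X (Rstar beta c q B X).
Proof.
split=> [i|].
  apply: filterS2 aeX mass01 => t x0 m01; rewrite RstarE.
  have /andP[p0 px] := phi_bounds i c_ge0 x0.
  by case: m01 => ->; rewrite ?mul0r ?mul1r ?lexx ?x0 ?p0.
apply/VaR_le => //.
set Z := (\sum_(i < n) X i - _ : {RV P >-> R}).
have mZ : measurable [set t | Z t <= c] by exact: measurable_sublevel.
(* It remains to bound [mass] by the indicator of coverage: where [mass] is 1, the vector is
   [phi(X)], which covers. *)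
rewrite -[P _]fineK ?fin_num_measure// lee_fin -mass_integral.
rewrite -(Rintegral_indicator (b := fun t => Z t <= c) P mZ)// -subr_ge0.
have iZ : integrableR (fun t => (Z t <= c)%R%:R) by exact: integrable_indicator mZ _.
rewrite -RintegralB//; apply: Rintegral_ae_ge0; first exact: integrable_realB iZ mass_int.
apply: filterS2 aeX mass01 => t x0 [] m; rewrite m ?subr0//.
rewrite (_ : Z t <= c) ?subrr//.
have := covered_phi c_ge0 x0; rewrite /covered /Z residual_riskE.
by under [X in _ - X <= c -> _]eq_bigr do rewrite -[phi _ _ _]mul1r -m -RstarE.
Qed.

(** Pointwise the weighted sum is [mass * W], which equals [(W < q) * (W - q) + q * mass]; and
    [mass] integrates to [alpha]. *)
Lemma cost_Rstar : cost beta (Rstar beta c q B X) = (K + q * alpha)%:E.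
Proof.
rewrite cost_Rintegral; last first.
  move=> i; apply: (integrable_ae_le _ (X_int i)); first exact: measurable_funPT.
  have [/(_ i) + _] := Rstar_feasible.
  by apply: filterS => t /andP[y0 yx]; rewrite !ger0_norm// (le_trans y0).
congr EFin; rewrite -mass_integral -RintegralZl// -RintegralD//; last first.
  exact: integrable_realZ.
apply: eq_Rintegral => t _; under eq_bigr do rewrite RstarE mulrCA.
rewrite -mulr_sumr -[\sum_i _]/(W t) /mass.
by case: ltgtP => [_|_|<-] /=; lra.
Qed.

Lemma Rstar_minimizer : minimizers alpha c beta X (Rstar beta c q B X).
Proof.
split; first exact: Rstar_feasible.
by move=> Y feasY; rewrite cost_Rstar; exact: cost_ge.
Qed.

Lemma minimizer_cost Y : minimizers alpha c beta X Y ->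
  cost beta Y = (K + q * alpha)%:E.
Proof.
move=> [feasY minY]; apply/eqP; rewrite eq_le cost_ge// andbT -cost_Rstar.
exact/minY/Rstar_feasible.
Qed.

End selection.

(** * Uniqueness when the strict sublevel has mass [alpha] *)

Section strict_sublevel_of_mass_alpha.
Hypothesis PD : P D = alpha%:E.

(** No mass is missing, so nothing is selected at level [q], and [Rstar0] becomes an instance of
    [Rstar]. *)
Let selector0 : selector beta c q alpha X (cst 0).
Proof.
split; first by apply: nearW => t; left.
by rewrite integral0 -/W -/D PD subee.
Qed.

Let Rstar0E i t : Rstar0 beta c q X i t = Rstar beta c q (cst 0) X i t.
Proof. by rewrite /= /Rstar0_fun /Rstar_fun/=; case: ltP; rewrite ?mul0r ?if_same. Qed.

Lemma Rstar0_unique_minimizer :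
  ae_singleton (minimizers alpha c beta X) (Rstar0 beta c q X).
Proof.
have RE : Rstar0 beta c q X = Rstar beta c q (cst 0) X.
  by apply/funext => i; apply/mfuneqP => t; exact: Rstar0E.
split; first by rewrite RE; exact: Rstar_minimizer.
move=> Y minY i; have feasY : feasible alpha c X Y by case: minY.
have [qA aeq] := cost_eq feasY (minimizer_cost selector0 minY).
have /andP[a0 _] := alpha01.
(* If [q = 0], then [D] would be null, against [P(D) = alpha > 0]. Slackness can then be divided by
   [q]. *)
have q0 : 0 < q.
  rewrite lt_neqAle VaR_W_ge0 andbT; apply/eqP => q0.
  by move: PD a0; rewrite /D -q0 W_lt0_null => -[<-]; rewrite ltxx.
have PA := mulfI (lt0r_neq0 q0) qA.
pose f t := (covered c (fun i => X i t) (fun i => Y i t))%:R - (W t < q)%R%:R : R.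
have iA : integrableR (fun t => (covered c (fun i => X i t) (fun i => Y i t))%:R).
  exact: integrable_indicator (measurable_covered Y) _.
have iD : integrableR (fun t => (W t < q)%R%:R) by exact: integrable_indicator mD _.
(* A zero gap puts [D] inside the covered event almost surely; equal masses make the two events
   agree. *)
have f0 : {ae P, forall t, f t = 0}.
  apply: Rintegral_ae_eq0; first exact: integrable_realB iA iD.
    apply: filterS aeq => t; rewrite /f; case: ifP => _ [_ ?].
      by rewrite subr_ge0 ler_nat leq_b1.
    by rewrite ltNge (_ : q <= W t)//= subrr.
  rewrite RintegralB// (Rintegral_indicator P (measurable_covered Y))//.
  by rewrite (Rintegral_indicator P mD)// PA PD subrr.
apply: filterS2 aeq f0 => t; rewrite /f /Rstar0/= /Rstar0_fun -/W.
case: ifP => _ [Yt _]; case: ltP => _ /= f0; rewrite Yt//.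
  by move/eqP: f0; rewrite subr0 oner_eq0.
by move/eqP: f0; rewrite sub0r oppr_eq0 oner_eq0.
Qed.

End strict_sublevel_of_mass_alpha.

(** * Selectors and non-uniqueness on an atomless space *)

Section atomless_space.
Hypothesis P_atomless : atomless P.
Hypothesis PD_lt : (P D < alpha%:E)%E.

Let a := alpha - fine (P D).

Let a_gt0 : 0 < a.
Proof. by rewrite subr_gt0 -lte_fin fineK// fin_num_measure. Qed.

Let indicRV (F : set T) (mF : measurable F) : {RV P >-> R} := indic_mfun F mF.

Let indicRVE (F : set T) (mF : measurable F) t : indicRV mF t = (t \in F)%:R.
Proof. exact: indicE. Qed.

Let selector_indic F (mF : measurable F) : F `<=` E -> P F = a%:E ->
  selector beta c q alpha X (indicRV mF).
Proof.
move=> FE PF; split.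
  by apply: nearW => t; rewrite indicRVE; case: (_ \in _); [right|left].
rewrite -/W -/E (integral_indic P mE mF) -/W -/E setIidl//.
rewrite [LHS]PF /a EFinB fineK//.
by rewrite fin_num_measure.
Qed.

Let PDE : P [set t | (W t <= q)%R] = (P D + P E)%E.
Proof.
rewrite -measureU//.
  by congr (P _); apply/seteqP; split => t; rewrite /D /E /= le_eqVlt;
    [case/predU1P => [|]; [right|left]|case=> [->|->]; rewrite ?orbT ?eqxx].
by apply/seteqP; split => t //= -[/[swap]]; rewrite /D/E/= => ->; rewrite ltxx.
Qed.

Let PE_fin : fine (P [set t | (W t <= q)%R]) = fine (P D) + fine (P E).
Proof. by rewrite PDE fineD ?fin_num_measure. Qed.

Let mWq : measurable [set t | W t <= q].
Proof. exact: measurable_sublevel. Qed.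

(** The mass missing from [D] is available at level [q] because [P(W <= q) >= alpha]. *)
Let a_le : a <= fine (P E).
Proof.
have := VaR_W_mass; rewrite -[P _]fineK ?fin_num_measure// lee_fin PE_fin.
by rewrite /a; lra.
Qed.

Let selection_event : exists F, [/\ measurable F, F `<=` E & P F = a%:E].
Proof. exact: (atomless_subset_of_measure P_atomless mE (ltW a_gt0)). Qed.

Lemma selector_exists : exists B, selector beta c q alpha X B.
Proof.
have [F [mF FE PF]] := selection_event.
by exists (indicRV mF); exact: selector_indic.
Qed.

(** Two selection events of the same mass give two minimizers; where the events differ, [W = q > 0]
    keeps the vectors apart. *)
Lemma not_ae_singleton_minimizers : 0 < q ->
  (alpha%:E < P [set t | (W t <= q)%R])%E ->
  ~ (exists Y, ae_singleton (minimizers alpha c beta X) Y).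
Proof.
move=> q0; rewrite -[P _]fineK ?fin_num_measure// lte_fin PE_fin => alt [Y [_ uY]].
have [F [mF FE PF]] := selection_event.
have mEF : measurable (E `\` F) by exact: measurableD.
have PEF : fine (P (E `\` F)) = fine (P E) - a.
  rewrite measureD//; last by rewrite ltey_eq fin_num_measure.
  by rewrite setIC setIidl// fineB ?fin_num_measure// [X in _ - fine X]PF.
(* Exchange part of [F] for an event [H] of equal mass outside [F]. *)
pose m := Num.min a (fine (P E) - a).
(* Room for the exchange: [P(W <= q) > alpha] means [a < P(E)]. *)
have m0 : 0 < m by rewrite lt_min a_gt0/=; rewrite /a; lra.
have ma : m <= a by rewrite ge_min lexx.
have mle : m <= fine (P (E `\` F)) by rewrite PEF ge_min lexx orbT.
have [H [mH HEF PH]] := atomless_subset_of_measure P_atomless mEF (ltW m0) mle.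
have am : a - m <= fine (P F) by rewrite PF/=; lra.
have am0 : 0 <= a - m by lra.
have [G [mG GF PG]] := atomless_subset_of_measure P_atomless mF am0 am.
have mGH : measurable (G `|` H) by exact: measurableU.
have selF := selector_indic mF FE PF.
have selGH : selector beta c q alpha X (indicRV mGH).
  apply: selector_indic.
    by rewrite subUset; split => t; [move=> /GF/FE|move=> /HEF[]].
  transitivity (P G + P H)%E; last by rewrite PG PH -EFinD subrK.
  by apply: measureU => //; apply/seteqP; split => t //= -[/GF Ft /HEF[_]].
have eqFGH i : {ae P, forall t, Rstar beta c q (indicRV mF) X i t =
    Rstar beta c q (indicRV mGH) X i t}.
  apply: filterS2 (uY _ (Rstar_minimizer selF) i) (uY _ (Rstar_minimizer selGH) i).
  by move=> t -> ->.
have [N [mN PN0 NH]] := filter_forall _ eqFGH.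
suff HN : H `<=` N.
  have PH0 : P H = 0%E by exact: subset_measure0 mH mN HN PN0.
  by move: m0; rewrite -lte_fin -PH PH0 ltxx.
(* On [H] the vector of [F] is 0 and the other is [phi(X)]; equality would give [phi(X) = 0], hence
   [W = 0]. *)
move=> t Ht; apply: NH => eqt.
have {}eqt i : Rstar beta c q (indicRV mF) X i t =
    Rstar beta c q (indicRV mGH) X i t by exact: eqt.
have [Et Ft] := HEF t Ht; have Wt : W t = q := Et.
suff : W t = 0 by rewrite Wt => q00; rewrite q00 ltxx in q0.
have RE (B : {RV P >-> R}) i :
    Rstar beta c q B X i t = B t * phi c (fun j => X j t) i.
  by rewrite /Rstar/= /Rstar_fun -/W Wt ltxx eqxx.
rewrite WE /beta_phi big1// => i _; have := eqt i.
rewrite !RE !indicRVE memNset// mul0r.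
by rewrite mem_set ?mul1r; [move=> <-; rewrite mulr0|right].
Qed.

End atomless_space.

End optimal_cost.

Theorem mainTheorem4 (d : measure_display) (T : measurableType d)
    (R : realType) (P : probability T R) (n : nat) (n_gt0 : (0 < n)%N)
    (X : 'I_n -> {RV P >-> R})
    (X_L1 : forall i, (X i : T -> R) \in Lfun P 1)
    (X_ge0 : forall i, {ae P, forall t, 0 <= X i t})
    (alpha : R) (alpha01 : 0 < alpha < 1)
    (c : R) (c_ge0 : 0 <= c)
    (beta : 'I_n -> R) (beta_gt0 : forall i, 0 < beta i)
    (beta_incr : forall i j : 'I_n, (i < j)%N -> beta i < beta j) :
  let C := minimizers alpha c beta X in
  let W := beta_phiRV beta c X in
  let q := VaR alpha W in
  (P [set t | W t < q] = alpha%:E ->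
     ae_singleton C (Rstar0 beta c q X))
  /\
  ((P [set t | (W t < q)%R] < alpha%:E)%E ->
   atomless P ->
     [/\ (* A nonsingleton C requires 0 < q and P(W <= q) > alpha: C is {0}
            if q = 0, and {phi(X) 1_(W <= q)} if P(W <= q) = alpha. *)
         0 < q -> (alpha%:E < P [set t | (W t <= q)%R])%E ->
           ~ (exists Y, ae_singleton C Y),
         exists B : {RV P >-> R}, selector beta c q alpha X B &
         forall B : {RV P >-> R}, selector beta c q alpha X B ->
           C (Rstar beta c q B X)]).
Proof.
move=> C W q; split=> [PD|PD P_atomless]; first exact: Rstar0_unique_minimizer.
split; first exact: not_ae_singleton_minimizers.
- exact: selector_exists.
- by move=> B; exact: Rstar_minimizer.
Qed.
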